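(* Let $A\in\mathbb{R}^{n\times n}$, $B\in\mathbb{R}^{n\times m}$ with $m\le n$, let $(A,B)$ be controllable, let $W\subseteq\mathbb{R}^n$ be nonempty, and let $X\subseteq\mathbb{R}^n$ and $U\subseteq\mathbb{R}^m$ be compact. Fix a constant $c\in\mathbb{R}_{>0}$ such that $\varepsilon'\mathbb{B}\subseteq N_n^{c\varepsilon'}$ for all $\varepsilon'\in\mathbb{R}_{>0}$. For $\varepsilon\in\mathbb{R}_{>0}$ let $i^*(\varepsilon)\in\mathbb{Z}_{\ge0}$ be the smallest index $i$ with $R_i\subseteq R_{i+n}+\varepsilon\mathbb{B}$ and let $$R_{(\varepsilon)}:=\bigcup_{j\in\{1,\dots,n\}}\bigl(R_{i^*(\varepsilon)+j}+N_j^{c\varepsilon}\bigr).$$ Let $R(X)$ be the maximal robust controlled invariant subset of $X$ with respect to the system $\xi(t+1)\in A\xi(t)+B\nu(t)+W$ and $U$. Then for any sequence $(\varepsilon_j)_{j\ge0}$ in $\mathbb{R}_{>0}$ with limit $0$, either $R_{(\varepsilon_j)}=\emptyset$ for some $j$, in which case $R(X)=\emptyset$, or $$\lim_{\varepsilon\to0,\ \varepsilon>0} d_H\bigl(R(X),R_{(\varepsilon)}\bigr)=0.$$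
   Context: $\mathbb{B}$ denotes the closed unit ball of the infinity norm $|\cdot|$ (in $\mathbb{R}^n$ or $\mathbb{R}^m$ according to context). Sums of sets are Minkowski sums (a sum with the empty set is empty), and $x+W$ means $\{x\}+W$. $(A,B)$ is controllable if $[B,AB,\dots,A^{n-1}B]$ has rank $n$. For $R\subseteq\mathbb{R}^n$, $\operatorname{pre}(R)=\{x\in\mathbb{R}^n\mid \exists u\in U:\ Ax+Bu+W\subseteq R\}$. The sequence $(R_i)_{i\in\mathbb{Z}_{\ge0}}$ is defined by $R_0=X$, $R_{i+1}=\operatorname{pre}(R_i)\cap X$. (An index $i$ with $R_i\subseteq R_{i+n}+\varepsilon\mathbb{B}$ always exists for $\varepsilon>0$.) For $\delta\in\mathbb{R}_{>0}$ the sets $N_i^\delta\subseteq\mathbb{R}^n$ are defined by $N_0^\delta=\{0\}$ and $N_{i+1}^\delta=\{x\in\mathbb{R}^n\mid \exists u\in\delta\mathbb{B}:\ Ax+Bu\in N_i^\delta\}\cap\delta\mathbb{B}$, where $u$ ranges over $\delta\mathbb{B}\subseteq\mathbb{R}^m$. A set $S\subseteq\mathbb{R}^n$ is robust controlled invariant with respect to the system $\xi(t+1)\in A\xi(t)+B\nu(t)+W$ and $U$ if for every $x\in S$ there exists $u\in U$ with $Ax+Bu+W\subseteq S$. This property is closed under unions, and $R(X)$ denotes the largest robust controlled invariant subset of $X$ (possibly empty). The Hausdorff distance is $d_H(P,Q)=\inf\{\eta\in\mathbb{R}_{\ge0}\mid Q\subseteq P+\eta\mathbb{B}\ \text{and}\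 P\subseteq Q+\eta\mathbb{B}\}$. *)

(* Defs.v *)
(* MathComp-Analysis. Vectors of R^n are columns 'cV[R]_n; the library norm
   `|x| on matrices is the maximum of the absolute values of the entries. *)
From mathcomp Require Import all_boot all_order all_algebra.
From mathcomp Require Import all_classical all_reals all_analysis.

Set Implicit Arguments.
Unset Strict Implicit.
Unset Printing Implicit Defensive.

Import Order.TTheory GRing.Theory Num.Theory.
Import numFieldNormedType.Exports.

Local Open Scope classical_set_scope.
Local Open Scope ring_scope.

Definition setsum (V : zmodType) (P Q : set V) : set V :=
  [set x + y | x in P & y in Q].

Definition unit_cball (R : realType) (n : nat) : set 'cV[R]_n :=
  [set x | `|x| <= 1].
Arguments unit_cball : clear implicits.

Definition scaled_cball (R : realType) (n : nat) (d : R) : set 'cV[R]_n :=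
  [set d *: x | x in unit_cball R n].
Arguments scaled_cball {R} n d _.

Definition controllable (R : realType) (n m : nat)
    (A : 'M[R]_n) (B : 'M[R]_(n, m)) : Prop :=
  \rank (\mxrow_(i < n) (A ^+ i *m B)) = n.

Definition pre (R : realType) (n m : nat) (A : 'M[R]_n) (B : 'M[R]_(n, m))
    (W : set 'cV[R]_n) (U : set 'cV[R]_m) (S : set 'cV[R]_n) : set 'cV[R]_n :=
  [set x | exists2 u, U u & setsum [set A *m x + B *m u] W `<=` S].

Fixpoint Rseq (R : realType) (n m : nat) (A : 'M[R]_n) (B : 'M[R]_(n, m))
    (W X : set 'cV[R]_n) (U : set 'cV[R]_m) (i : nat) : set 'cV[R]_n :=
  if i is i'.+1 then pre A B W U (Rseq A B W X U i') `&` X else X.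

Fixpoint Nseq (R : realType) (n m : nat) (A : 'M[R]_n) (B : 'M[R]_(n, m))
    (d : R) (i : nat) : set 'cV[R]_n :=
  if i is i'.+1 then
    [set x | exists2 u, scaled_cball m d u & Nseq A B d i' (A *m x + B *m u)]
      `&` scaled_cball n d
  else [set 0].

Definition stop_index (R : realType) (n m : nat)
    (A : 'M[R]_n) (B : 'M[R]_(n, m))
    (W X : set 'cV[R]_n) (U : set 'cV[R]_m) (e : R) (i : nat) : Prop :=
  Rseq A B W X U i `<=` setsum (Rseq A B W X U (i + n)) (scaled_cball n e).

(* The default 0 is irrelevant when X and U are compact and e > 0: a stopping
   index then exists. *)
Definition istar (R : realType) (n m : nat) (A : 'M[R]_n) (B : 'M[R]_(n, m))
    (W X : set 'cV[R]_n) (U : set 'cV[R]_m) (e : R) : nat :=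
  xget 0%N [set i | stop_index A B W X U e i /\
    forall k, stop_index A B W X U e k -> (i <= k)%N].

Definition Rapprox (R : realType) (n m : nat) (A : 'M[R]_n) (B : 'M[R]_(n, m))
    (W X : set 'cV[R]_n) (U : set 'cV[R]_m) (c e : R) : set 'cV[R]_n :=
  \bigcup_(j in [set j | (1 <= j <= n)%N])
    setsum (Rseq A B W X U (istar A B W X U e + j)) (Nseq A B (c * e) j).

Definition robust_controlled_invariant (R : realType) (n m : nat)
    (A : 'M[R]_n) (B : 'M[R]_(n, m))
    (W : set 'cV[R]_n) (U : set 'cV[R]_m) (S : set 'cV[R]_n) : Prop :=
  forall x, S x -> exists2 u, U u & setsum [set A *m x + B *m u] W `<=` S.

Definition max_rci (R : realType) (n m : nat) (A : 'M[R]_n) (B : 'M[R]_(n, m))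
    (W X : set 'cV[R]_n) (U : set 'cV[R]_m) : set 'cV[R]_n :=
  \bigcup_(S in [set S | S `<=` X /\ robust_controlled_invariant A B W U S]) S.

Lemma max_rci_largest (R : realType) (n m : nat)
    (A : 'M[R]_n) (B : 'M[R]_(n, m))
    (W X : set 'cV[R]_n) (U : set 'cV[R]_m) :
  [/\ max_rci A B W X U `<=` X,
      robust_controlled_invariant A B W U (max_rci A B W X U) &
      forall S, S `<=` X -> robust_controlled_invariant A B W U S ->
        S `<=` max_rci A B W X U].
Proof.
split.
- by move=> x [S [SX _] Sx]; exact: SX.
- move=> x [S [SX Sinv] Sx]; have [u Uu uS] := Sinv _ Sx.
  by exists u => // y /uS Sy; exists S.
- by move=> S SX Sinv x Sx; exists S.
Qed.

(* The infimum is taken in \bar R, so that the distance is +oo when no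
   radius qualifies, e.g. when exactly one of the sets is empty; the real-valued
   inf of the empty set is 0 in the library. *)
Definition hausdorff_dist (R : realType) (n : nat) (P Q : set 'cV[R]_n) :
    \bar R :=
  ereal_inf [set r%:E | r in [set r : R | [/\ 0 <= r,
    Q `<=` setsum P (scaled_cball n r) & P `<=` setsum Q (scaled_cball n r)]]].

(* Main.v *)
(* The sets R_i are compact and decrease to R(X), so every neighbourhood of R(X)
   contains some R_I. For small e the stopping index is either at least I, or
   an index i with R_i `<=` R_(i+n), in which case R_i is itself invariant and
   hence equal to R(X). As N_j^(c e) is contained in the ball of radius c e, the
   approximation lies between R(X) and a small thickening of R(X). When R(X) is
   empty this makes the approximation empty for small e, at distance 0, so the
   convergence holds in every case. *)
Require Import Defs.
From mathcomp Require Import all_boot all_order all_algebra.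
From mathcomp Require Import all_classical all_reals all_analysis.

Set Implicit Arguments.
Unset Strict Implicit.
Unset Printing Implicit Defensive.

Import Order.TTheory GRing.Theory Num.Theory.
Import numFieldNormedType.Exports.

Local Open Scope classical_set_scope.
Local Open Scope ring_scope.

(** * Nested compact sets *)

Lemma subset_decreasing (T : Type) (K : nat -> set T) :
  (forall i, K i.+1 `<=` K i) -> forall i j, (i <= j)%N -> K j `<=` K i.
Proof.
move=> Kdec i j /subnKC <-; elim: (j - i)%N => [|k IH]; first by rewrite addn0.
by rewrite addnS => x /Kdec/IH.
Qed.

(** A choice of points [x i] in [K i] clusters at some [p] by compactness of [K 0]. Each closed
    [K i] contains a tail of the sequence, hence [p]. *)
Lemma bigcap_compact_nonempty (T : topologicalType) (K : nat -> set T) :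
  compact (K 0%N) -> (forall i, closed (K i)) ->
  (forall i, K i.+1 `<=` K i) -> (forall i, K i !=set0) ->
  \bigcap_i K i !=set0.
Proof.
move=> K0 Kclosed Kdec Kn0.
have Kle i j := @subset_decreasing _ K Kdec i j.
have [x Kx] := choice Kn0.
have [|p [_ xp]] := K0 (x @ \oo) _.
  by exists 0%N => // i _; exact: Kle (Kx i).
exists p => i _; apply: (Kclosed i) => V /xp; apply.
by exists i => // j /= ij; exact: Kle (Kx j).
Qed.

(** * Balls, Hausdorff distance and convergence to 0 *)

Section Vectors.
Context {R : realType}.

Lemma mulmx_continuous (p q r : nat) (A : 'M[R]_(p, q)) :
  continuous (mulmx A : 'M[R]_(q, r) -> 'M[R]_(p, r)).
Proof.
apply: bounded_linear_continuous; apply/linear_boundedP.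
have entry_le s (x : 'M[R]_(s, r)) i j : `|x i j| <= `|x|.
  by rewrite [leRHS]mx_normrE (le_bigmax _ (fun ij => `|x ij.1 ij.2|) (i, j)).
(* The sum of all [|A i j|] dominates every absolute row sum, so it bounds the operator norm of [A]
   for the max norm. *)
apply: filterS (nbhs_pinfty_ge (num_real (\sum_i \sum_j `|A i j|))).
move=> C leC x; apply: (@le_trans _ _ ((\sum_i \sum_j `|A i j|) * `|x|)).
  rewrite [leLHS]mx_normrE; apply: bigmax_le => /= [|[i j] _ /=].
    by rewrite mulr_ge0// sumr_ge0// => i _; rewrite sumr_ge0.
  rewrite mxE (le_trans (ler_norm_sum _ _ _))//.
  rewrite (@le_trans _ _ ((\sum_j `|A i j|) * `|x|))//.
    by rewrite mulr_suml ler_sum// => k _; rewrite normrM ler_wpM2l.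
  rewrite ler_wpM2r// [leRHS](bigD1 i)//= lerDl sumr_ge0// => k _.
  by rewrite sumr_ge0.
by rewrite ler_wpM2r.
Qed.

Lemma scaled_cballE (n : nat) (r : R) :
  0 < r -> scaled_cball n r = [set x | `|x| <= r].
Proof.
move=> r0; apply/seteqP; split=> [_ [x /= x1 <-]|x /= xr].
  by rewrite /= normrZ gtr0_norm// ger_pMr.
exists (r^-1 *: x); last by rewrite scalerA divff ?gt_eqF// scale1r.
by rewrite /unit_cball/= normrZ gtr0_norm ?invr_gt0// ler_pdivrMl// mulr1.
Qed.

Lemma setsum_cballP (n : nat) (P : set 'cV[R]_n) (r : R) x : 0 < r ->
  setsum P (scaled_cball n r) x <-> exists2 p, P p & `|x - p| <= r.
Proof.
move=> r0; rewrite scaled_cballE//; split=> [[p Pp [y yr <-]]|[p Pp pr]].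
  by exists p; rewrite // [p + y]addrC addrK.
by exists p => //; exists (x - p) => //; rewrite subrKC.
Qed.

Lemma subset_setsum_cball (n : nat) (P : set 'cV[R]_n) (r : R) :
  0 < r -> P `<=` setsum P (scaled_cball n r).
Proof.
move=> r0 x Px; apply/setsum_cballP => //; exists x => //.
by rewrite subrr normr0 ltW.
Qed.

Lemma Nseq_ball (n m : nat) (A : 'M[R]_n) (B : 'M[R]_(n, m)) (d : R) j :
  0 < d -> Nseq A B d j `<=` [set x | `|x| <= d].
Proof.
move=> d0; case: j => [_ ->|j x [_]]; last by rewrite scaled_cballE.
by rewrite /= normr0 ltW.
Qed.

Lemma Nseq0 (n m : nat) (A : 'M[R]_n) (B : 'M[R]_(n, m)) (d : R) j :
  0 < d -> Nseq A B d j 0.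
Proof.
move=> d0; elim: j => [//|j IH]; split; last first.
  by rewrite scaled_cballE //= normr0 ltW.
by exists 0; rewrite ?mulmx0 ?addr0// scaled_cballE //= normr0 ltW.
Qed.

Lemma hausdorff_dist_ge0 (n : nat) (P Q : set 'cV[R]_n) :
  (0 <= hausdorff_dist P Q)%E.
Proof. by apply: le_ereal_inf_tmp => _ [r [r0 _ _] <-]; rewrite lee_fin. Qed.

Lemma hausdorff_dist_le (n : nat) (P Q : set 'cV[R]_n) (r : R) : 0 < r ->
  P `<=` Q -> Q `<=` setsum P (scaled_cball n r) ->
  (hausdorff_dist P Q <= r%:E)%E.
Proof.
move=> r0 PQ QP; apply: ereal_inf_lbound; exists r => //; split=> //.
  exact: ltW.
exact: subset_trans PQ (@subset_setsum_cball _ _ _ r0).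
Qed.

Lemma cvge_0 (T : Type) (F : set_system T) (FF : Filter F) (f : T -> \bar R) :
  (forall x, 0 <= f x)%E ->
  (forall r : R, 0 < r -> \forall x \near F, (f x <= r%:E)%E) ->
  f x @[x --> F] --> (0 : \bar R)%E.
Proof.
move=> f0 fr V /nbhs_EFin/nbhs_norm0P[d /= d0 dV].
(* Halving [d] turns the bound [<=] into the strict one that the ball requires. The two bounds on
   [f x] exclude both infinite values. *)
have := fr _ (divr_gt0 d0 (ltr0n R 2)); apply: filterS => x.
have := f0 x; rewrite /preimage /=; case: (f x) => [y| |]//.
rewrite !lee_fin => y0 yd.
apply: dV; rewrite /= ger0_norm// (le_lt_trans yd)//.
by rewrite ltr_pdivrMr// ltr_pMr// ltr1n.
Qed.

End Vectors.

(** * The iterates, the stopping index and the approximation *)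

Section Approximation.
Context {R : realType} {n m : nat} (A : 'M[R]_n) (B : 'M[R]_(n, m)).
Context (W X : set 'cV[R]_n) (U : set 'cV[R]_m).
Hypotheses (X_compact : compact X) (U_compact : compact U).

Let Rs := Rseq A B W X U.
Let M := max_rci A B W X U.

Lemma pre_subset (S T : set 'cV[R]_n) :
  S `<=` T -> pre A B W U S `<=` pre A B W U T.
Proof. by move=> ST x [u Uu uS]; exists u => //; exact: subset_trans ST. Qed.

Lemma Rseq_subset i : Rs i `<=` X.
Proof. by case: i => [//|i x []]. Qed.

Lemma RseqS_subset i : Rs i.+1 `<=` Rs i.
Proof.
elim: i => [x []//|i IH x [xpre Xx]].
by split=> //; exact: pre_subset xpre.
Qed.

Lemma Rseq_le i j : (i <= j)%N -> Rs j `<=` Rs i.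
Proof. exact: (@subset_decreasing _ Rs RseqS_subset). Qed.

(** The set is an intersection, over [w] in [W], of preimages of [S] under continuous maps. *)
Lemma closed_transition (S : set 'cV[R]_n) : closed S ->
  closed [set z : 'cV[R]_n * 'cV[R]_m |
    setsum [set A *m z.1 + B *m z.2] W `<=` S].
Proof.
move=> Sclosed.
rewrite (_ : mkset _ = \bigcap_(w in W)
    ((fun z : 'cV[R]_n * 'cV[R]_m => A *m z.1 + B *m z.2 + w) @^-1` S)).
  apply: closed_bigI => w _; apply: preimage_closed => // z _.
  apply: cvgD; last exact: cvg_cst.
  apply: cvgD.
    apply: (@continuous_comp _ _ _ fst (mulmx A)); first exact: cvg_fst.
    exact: mulmx_continuous.
  apply: (@continuous_comp _ _ _ snd (mulmx B)); first exact: cvg_snd.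
  exact: mulmx_continuous.
apply/seteqP; split=> z zS.
  by move=> w Ww; apply: zS; exists (A *m z.1 + B *m z.2) => //; exists w.
by move=> _ [_ -> [w Ww <-]]; exact: zS.
Qed.

(** The existential over inputs is a projection: [Rs i.+1] is the image under [fst] of a compact set
    of pairs of state and input. *)
Lemma Rseq_compact i : compact (Rs i).
Proof.
elim: i => [//|i IH].
pose K := (X `*` U) `&` [set z : 'cV[R]_n * 'cV[R]_m |
  setsum [set A *m z.1 + B *m z.2] W `<=` Rs i].
rewrite (_ : Rs i.+1 = fst @` K).
  apply: continuous_compact.
    by apply: continuous_subspaceT => z; exact: cvg_fst.
  apply: compact_closedI; first exact: compact_setX.
  by apply: closed_transition; exact: compact_closed (@norm_hausdorff _ _) IH.
apply/seteqP; split=> [x [[u Uu uS] Xx]|_ [[x u] [[Xx Uu] uS] <-]].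
  by exists (x, u).
by split=> //; exists u.
Qed.

Lemma Rseq_closed i : closed (Rs i).
Proof. exact: compact_closed (@norm_hausdorff _ _) (@Rseq_compact i). Qed.

Lemma rci_subset_Rseq i : M `<=` Rs i.
Proof.
have [MX Minv _] := max_rci_largest A B W X U.
elim: i => [//|i IH] x Mx; split; last exact: MX.
have [u Uu uM] := Minv _ Mx; exists u => //; exact: subset_trans uM IH.
Qed.

(** The intersection is itself invariant: for [x] in it, the inputs steering [x] into [Rs i] form
    nested nonempty compact sets [K i], and an input common to all of them keeps the successors in
    every [Rs i]. *)
Lemma max_rciE : M = \bigcap_i Rs i.
Proof.
apply/seteqP; split=> [x Mx i _|]; first exact: rci_subset_Rseq.
have [_ _] := max_rci_largest A B W X U; apply=> [x /(_ 0%N I)//|x Rx].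
pose K i := U `&` [set u | setsum [set A *m x + B *m u] W `<=` Rs i].
have Kclosed i : closed [set u | setsum [set A *m x + B *m u] W `<=` Rs i].
  apply: (@preimage_closed _ _ (fun u : 'cV[R]_m => (x, u)) _ _
    (@closed_transition _ (@Rseq_closed i))) => u _.
  exact: (cvg_pair (cvg_cst x) (@cvg_id _ (nbhs u))).
have [||||u Ku] := @bigcap_compact_nonempty _ K.
- exact: compact_closedI.
- move=> i; apply: closedI => //.
  exact: compact_closed (@norm_hausdorff _ _) U_compact.
- by move=> i u [Uu uR]; split=> //; exact: subset_trans (@RseqS_subset i).
- by move=> i; have [[u Uu uR] _] := Rx i.+1 I; exists u.
exists u; first by have [] := Ku 0%N I.
by move=> y yu i _; have [_] := Ku i I; exact.
Qed.

(** Otherwise the points of [Rs i] at distance at least [r] from all of [M] form nested nonempty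
    compact sets. A common point lies in [M] by [max_rciE], yet is at distance 0 from itself. For
    empty [M] this says that some [Rs i] is empty. *)
Lemma Rseq_approach (r : R) : 0 < r ->
  exists i, Rs i `<=` setsum M (scaled_cball n r).
Proof.
move=> r0; apply: contrapT => /forallNP noti.
pose far := \bigcap_(p in M) [set x : 'cV[R]_n | r <= `|x - p|].
have far_closed : closed far.
  apply: closed_bigI => p _.
  apply: (@preimage_closed _ _ (fun x : 'cV[R]_n => `|x - p|) [set y | r <= y]);
    last exact: closed_ge.
  move=> x _; exact: cvg_norm (cvgB (@cvg_id _ (nbhs x)) (cvg_cst p)).
have [||||x Kx] := @bigcap_compact_nonempty _ (fun i => Rs i `&` far).
- exact: compact_closedI (@Rseq_compact 0%N) far_closed.
- by move=> i; apply: closedI (@Rseq_closed i) far_closed.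
- by move=> i x [Rx fx]; split=> //; exact: RseqS_subset.
- move=> i; have /existsNP[x /not_implyP[Rx xM]] := noti i.
  exists x; split=> // p Mp; rewrite /= leNgt; apply/negP => /ltW xp.
  by apply: xM; apply/setsum_cballP => //; exists p.
have Mx : M x by rewrite max_rciE => i _; have [] := Kx i I.
by have [_ /(_ _ Mx)] := Kx 0%N I; rewrite /= subrr normr0 leNgt r0.
Qed.

(** Any [i] with [Rs i] in the [e]-thickening of [M] is a stopping index, because [M] lies in
    [Rs (i + n)]. So the default of [xget] is never taken. *)
Lemma istarP (e : R) : 0 < e ->
  stop_index A B W X U e (istar A B W X U e).
Proof.
move=> e0; have [i iM] := Rseq_approach e0.
have stop : exists i, `[< stop_index A B W X U e i >].
  exists i; apply/asboolP => x /iM [y My yx].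
  by exists y => //; exact: rci_subset_Rseq.
rewrite /istar; set P := mkset _.
suff : P (xget 0%N P) by case.
apply: xgetPex; exists (ex_minn stop); case: ex_minnP => k /asboolP kstop kmin.
by split=> // l /asboolP; exact: kmin.
Qed.

(** As [n] is positive, [Rs (i + n)] lies in [Rs i.+1], hence in the [pre] of [Rs i]; so [Rs i] is
    invariant. *)
Lemma Rseq_stationary i : (0 < n)%N -> Rs i `<=` Rs (i + n) -> Rs i `<=` M.
Proof.
move=> n0 Rin; have [_ _] := max_rci_largest A B W X U.
apply=> [|x /Rin Rx]; first exact: Rseq_subset.
have /Rseq_le/(_ _ Rx)[//] : (i.+1 <= i + n)%N by rewrite -addn1 leq_add2l.
Qed.

(** If [i] is not stationary, some [x] in [Rs i] has a ball of radius [d] disjoint from the closed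
    set [Rs (i + n)], so [i] cannot stop for [e < d]. *)
Lemma near_stop_index i : (0 < n)%N ->
  \forall e \near (0 : R)^'+, stop_index A B W X U e i -> Rs i `<=` M.
Proof.
move=> n0.
have [Rin|/existsNP[x /not_implyP[Rx xn]]] := pselect (Rs i `<=` Rs (i + n)).
  by apply: nearW => e _; exact: Rseq_stationary.
have : nbhs x (~` Rs (i + n)).
  by apply: open_nbhs_nbhs; split=> //; apply: closed_openC; exact: Rseq_closed.
move=> /nbhs_normP[d /= d0 dR]; near=> e => /(_ _ Rx).
have e0 : 0 < e by near: e; exact: nbhs_right_gt.
move=> /setsum_cballP-/(_ e0)[p Rp xp]; case: (dR p) => //=.
by rewrite (le_lt_trans xp)//; near: e; exact: nbhs_right_lt.
Unshelve. all: by end_near. Qed.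

Lemma near_Rseq_istar (r : R) : (0 < n)%N -> 0 < r ->
  \forall e \near (0 : R)^'+,
    Rs (istar A B W X U e) `<=` setsum M (scaled_cball n r).
Proof.
move=> n0 r0; have [k kM] := Rseq_approach r0.
(* Only finitely many indices lie below [k], so one threshold on [e] serves them all. *)
have small : \forall e \near (0 : R)^'+,
    forall i, (i < k)%N -> stop_index A B W X U e i -> Rs i `<=` M.
  elim: {kM} k => [|k IH]; first by apply: nearW.
  apply: filterS2 IH (near_stop_index k n0) => e ltk eqk i.
  by rewrite ltnS leq_eqVlt => /predU1P[->|/ltk].
near=> e.
have e0 : 0 < e by near: e; exact: nbhs_right_gt.
have [ik|ki] := ltnP (istar A B W X U e) k.
  apply: (subset_trans _ (@subset_setsum_cball _ _ _ _ r0)).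
  by apply: (near small e) => //; exact: istarP.
exact: subset_trans (@Rseq_le _ _ ki) kM.
Unshelve. all: by end_near. Qed.

Lemma rci_subset_Rapprox (c e : R) : (0 < n)%N -> 0 < c -> 0 < e ->
  M `<=` Rapprox A B W X U c e.
Proof.
(* The term [j = 1] is present since [n] is positive, and its [Nseq] summand contains 0. *)
move=> n0 c0 e0 x Mx; exists 1%N => //.
exists x; first exact: rci_subset_Rseq.
by exists 0; [exact/Nseq0/mulr_gt0|rewrite addr0].
Qed.

Lemma Rapprox_cvg (c : R) : (0 < n)%N -> 0 < c ->
  hausdorff_dist M (Rapprox A B W X U c e) @[e --> (0 : R)^'+]
    --> (0 : \bar R)%E.
Proof.
move=> n0 c0; apply: cvge_0 => [e|r r0]; first exact: hausdorff_dist_ge0.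
(* One half of [r] pays for the distance from the iterate to [M], the other for the [Nseq] summand,
   of norm at most [c * e]. *)
have r20 : 0 < r / 2 by rewrite divr_gt0.
near=> e.
have e0 : 0 < e by near: e; exact: nbhs_right_gt.
have cer : c * e <= r / 2.
  by rewrite -ler_pdivlMl//; near: e; apply: nbhs_right_ltW;
    rewrite mulr_gt0 ?invr_gt0.
apply: hausdorff_dist_le => //; first exact: rci_subset_Rapprox.
move=> _ [j _ [y Ry [z Nz <-]]]; apply/setsum_cballP => //.
have /setsum_cballP-/(_ r20)[p Mp yp] : setsum M (scaled_cball n (r / 2)) y.
  apply: (near (near_Rseq_istar n0 r20) e) => //.
  exact: Rseq_le (leq_addr _ _) _ Ry.
exists p => //; rewrite addrAC (le_trans (ler_normD _ _))//.
rewrite [leRHS]splitr lerD//.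
by apply: le_trans cer; exact: Nseq_ball (mulr_gt0 c0 e0) _ Nz.
Unshelve. all: by end_near. Qed.

End Approximation.

Theorem corollary2 (R : realType) (n m : nat)
    (A : 'M[R]_n) (B : 'M[R]_(n, m))
    (W X : set 'cV[R]_n) (U : set 'cV[R]_m) (c : R) (eps : nat -> R)
    (n_gt0 : (0 < n)%N)
    (le_mn : (m <= n)%N)
    (ctrlAB : controllable A B)
    (W_nonempty : W !=set0)
    (X_compact : compact X)
    (U_compact : compact U)
    (c_gt0 : 0 < c)
    (cP : forall e : R, 0 < e -> scaled_cball n e `<=` Nseq A B (c * e) n)
    (eps_gt0 : forall j, 0 < eps j)
    (eps_cvg0 : eps j @[j --> \oo] --> (0 : R)) :
  ((exists j, Rapprox A B W X U c (eps j) = set0) ->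
     max_rci A B W X U = set0) /\
  ((exists j, Rapprox A B W X U c (eps j) = set0) \/
   hausdorff_dist (max_rci A B W X U) (Rapprox A B W X U c e)
     @[e --> (0 : R)^'+] --> (0 : \bar R)%E).
Proof.
(* Convergence holds unconditionally, which settles the alternative; an empty approximation forces
   [M] to be empty because it contains [M]. *)
split=> [[j Rj]|]; last by right; exact: Rapprox_cvg.
by rewrite -subset0 -Rj; exact: rci_subset_Rapprox.
Qed.
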